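(* Let $n\ge5$ and $\alpha,\beta\in\mathcal{E}_n=\mathrm{End}(\mathcal{T}_n)$. Then the following conditions are equivalent: (1) $\alpha\mathrel{\mathscr{R}^*}\beta$; (2) $\alpha\mathrel{\widetilde{\mathscr{R}}}\beta$; (3) $\alpha$ and $\beta$ are $\mathscr{R}$-below the same idempotents; (4) $\alpha$ and $\beta$ are $\mathscr{J}$-below the same idempotents; (5) $\alpha$ and $\beta$ have the same rank. Consequently, $\widetilde{\mathscr{R}}=\mathscr{R}^*$ is a left congruence and the $\mathscr{R}^*$-classes of $\mathcal{E}_n$ are $\mathcal{G}_n$, $E_3\cup A\cup B$, $E_2\cup C$ and $E_1$.
   Context: Maps are written on the right and composed left to right. $\mathcal{T}_n$ is the full transformation semigroup of all maps $\{1,\dots,n\}\to\{1,\dots,n\}$; $\mathcal{S}_n$, $\mathcal{A}_n$ are the symmetric and alternating groups, $\mathrm{id}$ the identity map, and $s^g=g^{-1}sg$ for $g\in\mathcal{S}_n$, $s\in\mathcal{T}_n$. $\mathcal{E}_n=\mathrm{End}(\mathcal{T}_n)$ is the monoid of all semigroup endomorphisms of $\mathcal{T}_n$ (not required to fix $\mathrm{id}$), and $\mathcal{G}_n=\mathrm{Aut}(\mathcal{T}_n)$. The rank of $\alpha\in\mathcal{E}_n$ is the cardinality of its image. For $g\in\mathcal{S}_n$, $\psi_g:s\mapsto s^g$. For $t,e\in\mathcal{T}_n$, $\phi_{t,e}$ sends $s\mapsto t$ if $s\in\mathcal{S}_n\setminus\mathcal{A}_n$, $s\mapsto t^2$ if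 $s\in\mathcal{A}_n$, $s\mapsto e$ if $s\in\mathcal{T}_n\setminus\mathcal{S}_n$. By a known theorem of Schein and Teclezghi, $\mathcal{G}_n=\{\psi_g:g\in\mathcal{S}_n\}$ and, for $n\neq4$, $\mathcal{E}_n=\mathcal{G}_n\cup\{\phi_{t,e}: t^3=t,\ te=et=e^2=e\}$. Define (in each case $\phi_{t,e}$ is assumed to lie in $\mathcal{E}_n$): $E_3=\{\phi_{t,e}: t\in\mathcal{S}_n\setminus\mathcal{A}_n,\ e\ne\mathrm{id}\}$; $A=\{\phi_{t,e}: t\in\mathcal{A}_n,\ t\neq\mathrm{id},\ e\neq\mathrm{id}\}$; $B=\{\phi_{t,e}: t\in\mathcal{T}_n\setminus\mathcal{S}_n,\ t\ne t^2,\ t^2\neq e,\ e\ne\mathrm{id}\}$; $E_2=\{\phi_{\mathrm{id},e}: e\ne\mathrm{id}\}$; $C=\{\phi_{t,e}: t\in\mathcal{T}_n\setminus\mathcal{S}_n,\ t=t^2,\ t\neq e,\ e\neq\mathrm{id}\}$; $E_1=\{\phi_{e,e}\}$. Relations on $\mathcal{E}_n$: $\alpha\mathrel{\mathscr{R}^*}\beta$ iff for all $\gamma,\delta\in\mathcal{E}_n$, $\gamma\alpha=\delta\alpha\Leftrightarrow\gamma\beta=\delta\beta$. $\alpha\mathrel{\widetilde{\mathscr{R}}}\beta$ iff for all idempotents $\eta\in\mathcal{E}_n$, $\eta\alpha=\alpha\Leftrightarrow\eta\beta=\beta$. $\alpha$ is $\mathscr{R}$-below $\eta$ if $\alpha\mathcal{E}_n\subseteq\eta\mathcal{E}_n$;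 $\alpha$ is $\mathscr{J}$-below $\eta$ if $\mathcal{E}_n\alpha\mathcal{E}_n\subseteq\mathcal{E}_n\eta\mathcal{E}_n$. A left congruence is an equivalence relation compatible with left multiplication. *)

(* Defs.v *)
From HB Require Import structures.
From mathcomp Require Import all_boot all_fingroup all_solvable.
Set Implicit Arguments.
Unset Strict Implicit.
Unset Printing Implicit Defensive.
Local Open Scope group_scope.

(* A wrapper record, not an alias: {ffun aT -> rT} carries the pointwise
   product of monoid.v whenever rT has one, and must not be confused with
   composition. *)
Record transf (n : nat) := Transf { transf_fun :> {ffun 'I_n -> 'I_n} }.

Section Transf.
Variable n : nat.
Implicit Types (s t u e : transf n) (g : 'S_n).

HB.instance Definition _ := [isNew for @transf_fun n].
HB.instance Definition _ := [Finite of transf n by <:].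

(* Maps act on the right: x (s * t) = (x s) t, as for permutations. *)
Definition transf_mul s t : transf n := Transf [ffun x => t (s x)].
Definition transf_one : transf n := Transf [ffun x => x].

Lemma transf_mulA : associative transf_mul.
Proof. by move=> s t u; apply/val_inj/ffunP=> x; rewrite !ffunE. Qed.
Lemma transf_mul1 : left_id transf_one transf_mul.
Proof. by move=> s; apply/val_inj/ffunP=> x; rewrite !ffunE. Qed.
Lemma transf_mulr1 : right_id transf_one transf_mul.
Proof. by move=> s; apply/val_inj/ffunP=> x; rewrite !ffunE. Qed.

HB.instance Definition _ :=
  isMonoid.Build (transf n) transf_mulA transf_mul1 transf_mulr1.

Definition transf_of_perm g : transf n := Transf [ffun x => g x].
Definition symT : {set transf n} := [set transf_of_perm g | g in 'Sym_('I_n)].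
Definition altT : {set transf n} := [set transf_of_perm g | g in 'Alt_('I_n)].

End Transf.

(* Semigroup endomorphisms: 1 need not be fixed. *)
Record endo (n : nat) := Endo {
  endo_fun :> {ffun transf n -> transf n};
  _ : [forall s : transf n, [forall t : transf n, endo_fun (s * t) == endo_fun s * endo_fun t]]
}.

Section Endo.
Variable n : nat.
Implicit Types (s t e : transf n) (a b c d eta : endo n).

HB.instance Definition _ := [isSub for @endo_fun n].
HB.instance Definition _ := [Finite of endo n by <:].

Lemma endoM a : {morph a : s t / s * t}.
Proof. by case: a => f /= fM s t; apply/eqP; move/forallP/(_ s)/forallP: fM. Qed.

Fact endo_mul_subproof a b :
  let f : {ffun transf n -> transf n} := [ffun s => b (a s)] in
  [forall s : transf n, [forall t : transf n, f (s * t) == f s * f t]].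
Proof. by do 2!apply/forallP=> ?; rewrite !ffunE !endoM. Qed.

Fact endo_one_subproof :
  let f : {ffun transf n -> transf n} := [ffun s => s] in
  [forall s : transf n, [forall t : transf n, f (s * t) == f s * f t]].
Proof. by do 2!apply/forallP=> ?; rewrite !ffunE. Qed.

(* As in T_n, [a * b] applies [a] first. *)
Definition endo_mul a b : endo n := Endo (endo_mul_subproof a b).
Definition endo_one : endo n := Endo endo_one_subproof.

Lemma endo_mulA : associative endo_mul.
Proof. by move=> a b c; apply/val_inj/ffunP=> x; rewrite !ffunE. Qed.
Lemma endo_mul1 : left_id endo_one endo_mul.
Proof. by move=> a; apply/val_inj/ffunP=> x; rewrite !ffunE. Qed.
Lemma endo_mulr1 : right_id endo_one endo_mul.
Proof. by move=> a; apply/val_inj/ffunP=> x; rewrite !ffunE. Qed.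

HB.instance Definition _ :=
  isMonoid.Build (endo n) endo_mulA endo_mul1 endo_mulr1.

Definition endo_rank a : nat := #|[set a s | s : transf n]|.

Definition aut_endo : {set endo n} :=
  [set a : endo n | injectiveb a & [forall t : transf n, exists s : transf n, a s == t]].

Definition phi t e : {ffun transf n -> transf n} :=
  [ffun s => if s \in symT n :\: altT n then t
             else if s \in altT n then t ^+ 2
             else e].

(* The endomorphisms of the form phi_{t,e} with P t e; pairs (t, e) for which
   phi_{t,e} is not an endomorphism contribute nothing. *)
Definition phi_class (P : rel (transf n)) : {set endo n} :=
  [set a : endo n | [exists t : transf n, exists e : transf n, P t e && (endo_fun a == phi t e)]].

Definition phiE3 := phi_class (fun t e => (t \in symT n :\: altT n) && (e != 1)).
Definition phiA := phi_class (fun t e => [&& t \in altT n, t != 1 & e != 1]).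
Definition phiB :=
  phi_class (fun t e => [&& t \notin symT n, t != t ^+ 2, t ^+ 2 != e & e != 1]).
Definition phiE2 := phi_class (fun t e => (t == 1) && (e != 1)).
Definition phiC :=
  phi_class (fun t e => [&& t \notin symT n, t == t ^+ 2, t != e & e != 1]).
Definition phiE1 := phi_class (fun t e => t == e).

Definition idempotentE eta : bool := eta * eta == eta.

Definition Rstar : rel (endo n) := fun a b =>
  [forall c : endo n, forall d : endo n, (c * a == d * a) == (c * b == d * b)].

Definition Rtilde : rel (endo n) := fun a b =>
  [forall eta : endo n, idempotentE eta ==> ((eta * a == a) == (eta * b == b))].

Definition Rbelow a eta : bool :=
  [set a * c | c : endo n] \subset [set eta * c | c : endo n].

Definition Jbelow a eta : bool :=
  [set c * a * d | c : endo n, d : endo n]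
    \subset [set c * eta * d | c : endo n, d : endo n].

Definition left_congruence (R : rel (endo n)) : Prop :=
  equivalence_rel R /\ forall c a b, R a b -> R (c * a) (c * b).

End Endo.

(* Main.v *)
Require Import Defs.
From mathcomp Require Import all_boot all_fingroup all_solvable.

Set Implicit Arguments.
Unset Strict Implicit.
Unset Printing Implicit Defensive.

(** Everything is governed by the rank, because an endomorphism of T_n has only
    four possible kernels, and these form a chain in which a larger rank means
    a smaller kernel.

    The kernels come from the dichotomy [noninj_endo_phi]: for n >= 5 an
    endomorphism a that is not injective is some phi_{t,e}. If a identifies two
    distinct maps, then it identifies two, hence all, constant maps
    ([const_collapse]); their common image z is a left zero of the image of a.
    The permutations therefore act, through a, on the image of the idempotent
    a 1, and they fix every point of the image of z. Fixing a point, this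
    action maps S_n into a group of order (n-1)!, which is less than n!/2, so
    it is not faithful on A_n; as A_n is simple, it is trivial there
    ([alt_trivial_fix], [alt_collapse]). Thus a takes one value on the even
    permutations and one on the odd ones. Finally, all idempotents [merge i j]
    of defect 1 are conjugate, so they share one value, which is idempotent;
    since a product of them is constant, that value is z ([merge_zero]).
    Every singular map is absorbed on the left by such an idempotent, so its
    image is z too.

    For phi_{t,e} one reads off the rank 1 + [t <> e] + [t^2 <> t], and hence
    [rank_ker]: if rank a <= rank b, then the kernel of b is contained in that
    of a. For an idempotent eta, the equation eta a = a says that the kernel of
    eta is contained in that of a; so it holds exactly when
    rank a <= rank eta. The same inequality describes being R-below or J-below
    eta ([idempotent_fix_rank], [Rbelow_rank], [Jbelow_rank]). Since every rank
    is attained by an idempotent ([exists_idempotent_rank]), the conditions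
    about idempotents all say that the ranks agree. Equal ranks give equal
    kernels, and gamma a = delta a depends only on the kernel of a, which gives
    R^*; conversely R^* implies the condition on idempotents by taking delta to
    be the identity. The classes are then the sets of endomorphisms of rank
    n^n, 3, 2 and 1, matched with the families phi_{t,e} by [mem_phi_class]. *)

(** * Permutations, constants and idempotents of defect one *)

Section Transformations.
Local Open Scope group_scope.
Variable n : nat.
Implicit Types (s t u e : transf n) (g h : 'S_n) (i j k x : 'I_n).

Lemma transfP s t : (forall x, s x = t x) -> s = t.
Proof. by move=> st; apply/val_inj/ffunP. Qed.

Lemma transf_mulE s t x : (s * t) x = t (s x).
Proof. by rewrite ffunE. Qed.

Lemma transf_of_permE g x : transf_of_perm g x = g x.
Proof. by rewrite ffunE. Qed.

Lemma transf_of_permM : {morph @transf_of_perm n : g h / g * h}.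
Proof. by move=> g h; apply: transfP => x; rewrite !ffunE permM. Qed.

Lemma transf_of_perm1 : transf_of_perm (1 : 'S_n) = 1.
Proof. by apply: transfP => x; rewrite !ffunE perm1. Qed.

Lemma transf_of_perm_inj : injective (@transf_of_perm n).
Proof.
by move=> g h gh; apply/permP=> x; rewrite -!transf_of_permE gh.
Qed.

Lemma transf_of_perm_symT g : transf_of_perm g \in symT n.
Proof. by apply: imset_f; rewrite inE. Qed.

Lemma transf_of_perm_altT g : (transf_of_perm g \in altT n) = ~~ odd_perm g.
Proof.
by rewrite mem_imset ?Alt_even //; exact: transf_of_perm_inj.
Qed.

Lemma symTP s : reflect (injective s) (s \in symT n).
Proof.
apply: (iffP imsetP) => [[g _ ->] x y|s_inj].
  by rewrite !transf_of_permE => /perm_inj.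
exists (perm s_inj); first by rewrite inE.
by apply: transfP => x; rewrite ffunE permE.
Qed.

Variant transf_spec s : transf n -> bool -> Prop :=
  | TransfPerm g of s = transf_of_perm g : transf_spec s (transf_of_perm g) true
  | TransfSing of s \notin symT n : transf_spec s s false.

Lemma transf_symP s : transf_spec s s (s \in symT n).
Proof.
have [sS|sS] := boolP (s \in symT n); last exact: TransfSing.
by case/imsetP: sS => g _ sg; rewrite {2}sg; apply: TransfPerm.
Qed.

Lemma notin_symTP s : reflect (exists2 ij, ij.1 != ij.2 & s ij.1 = s ij.2) (s \notin symT n).
Proof.
apply: (iffP negP) => [sS|[[i j] /= /eqP nij sij] /symTP/(_ i j sij) //].
have /injectivePn[i [j nij sij]] : ~~ injectiveb s by apply/injectiveP=> /symTP.
by exists (i, j).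
Qed.

Definition const_transf i : transf n := Transf [ffun=> i].

Lemma const_transfE i x : const_transf i x = i.
Proof. by rewrite ffunE. Qed.

Lemma const_transf_mul s i : const_transf i * s = const_transf (s i).
Proof. by apply: transfP => x; rewrite !ffunE. Qed.

Lemma mul_const_transf s i : s * const_transf i = const_transf i.
Proof. by apply: transfP => x; rewrite !ffunE. Qed.

(** For [i != j], these are the idempotents of rank n - 1. *)
Definition merge i j : transf n := Transf [ffun x => if x == i then j else x].

Lemma merge_conj g i j :
  merge (g i) (g j) = transf_of_perm g^-1 * merge i j * transf_of_perm g.
Proof.
apply: transfP => x; rewrite !ffunE -[g^-1 x == i](inj_eq (@perm_inj _ g)) permKV.
by case: eqP => // _; rewrite permKV.
Qed.

(** Taking [i != j] with the same image shows that every singular map has a left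
    factor of defect 1; this is how statements about [merge] reach all singular
    maps. *)
Lemma merge_absorb s i j : s i = s j -> merge i j * s = s.
Proof.
by move=> sij; apply: transfP => x; rewrite !ffunE; case: eqP => // ->.
Qed.

Lemma mul_symT s t : (s * t \in symT n) = (s \in symT n) && (t \in symT n).
Proof.
case: (transf_symP s) => [g _|/notin_symTP[[i j] /= nij sij]] /=; last first.
  by apply/negbTE/notin_symTP; exists (i, j); rewrite // !transf_mulE sij.
case: (transf_symP t) => [h _|/notin_symTP[[i j] /= nij tij]] /=.
  by rewrite -transf_of_permM transf_of_perm_symT.
apply/negbTE/notin_symTP; exists (g^-1 i, g^-1 j); rewrite ?(inj_eq perm_inj) //.
by rewrite !transf_mulE !transf_of_permE !permKV.
Qed.

Lemma altT_sub s : s \in altT n -> s \in symT n.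
Proof. by move=> /imsetP[g _ ->]; apply: transf_of_perm_symT. Qed.

Lemma phi_perm t e g : phi t e (transf_of_perm g) = if odd_perm g then t else t ^+ 2.
Proof.
by rewrite ffunE inE transf_of_perm_symT transf_of_perm_altT negbK andbT; case: odd_perm.
Qed.

Lemma phi_sing t e s : s \notin symT n -> phi t e s = e.
Proof.
by move=> sS; rewrite ffunE inE (negPf sS) andbF; case: ifP => // /altT_sub; rewrite (negPf sS).
Qed.

End Transformations.

(** * Which phi are endomorphisms *)

Section Endomorphisms.
Local Open Scope group_scope.
Variable n : nat.
Implicit Types (s t u e : transf n) (a b c d eta : endo n) (g h : 'S_n).

Lemma endoP a b : (forall s, a s = b s) -> a = b.
Proof. by move=> ab; apply/val_inj/ffunP. Qed.

Lemma endo_mulE a b s : (a * b) s = b (a s).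
Proof. by rewrite ffunE. Qed.

Lemma endo_oneE s : (1 : endo n) s = s.
Proof. by rewrite ffunE. Qed.

Definition phi_admissible t e :=
  [/\ t * t * t = t, t * e = e, e * t = e & e * e = e].

Lemma admissible_e1 t e : phi_admissible t e -> t != e -> e != 1.
Proof. by case=> _ te _ _; apply: contraNneq => e1; rewrite -te e1 mulg1. Qed.

(** If [t * t = e] then [t = t * t * t = e * t = e], and then [t * t = t]; so a
    non-idempotent [t] yields three distinct elements [t], [t * t], [e]. *)
Lemma admissible_sqr t e :
  phi_admissible t e -> t * t != t -> (t != e) && (t * t != e).
Proof.
case=> ttt te et ee tt; apply/andP; split.
  by apply: contraNneq tt => ->; rewrite ee.
by apply: contraNneq tt => tte; rewrite -[X in _ == X]ttt tte et.
Qed.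

Lemma phi_endo t e : phi_admissible t e -> {a : endo n | endo_fun a = phi t e}.
Proof.
case=> ttt te et ee.
suff phiM : [forall s : transf n, forall u : transf n, phi t e (s * u) == phi t e s * phi t e u].
  by exists (Endo phiM).
have tte : t * t * e = e by rewrite -mulgA te te.
have ett : e * (t * t) = e by rewrite mulgA et et.
apply/forallP=> s; apply/forallP=> u.
have := mul_symT s u.
case: (transf_symP s) => [g _|sS] /=; last first.
  move/negbT=> suS; rewrite (phi_sing _ _ suS) (phi_sing _ _ sS).
  by rewrite ffunE !expg2; case: ifP => _; last case: ifP => _; rewrite ?et ?ett ?ee.
case: (transf_symP u) => [h _ _|uS].
  rewrite -transf_of_permM !phi_perm odd_permM !expg2.
  by do 2!case: odd_perm => /=; rewrite ?ttt ?mulgA ?ttt.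
move/negbT=> suS; rewrite (phi_sing _ _ suS) (phi_sing _ _ uS).
by rewrite phi_perm !expg2; case: odd_perm; rewrite ?te ?tte.
Qed.

(** * Collapse of the constants and of the alternating group *)

(** The image of an endomorphism is a monoid with unit [a 1], even when [a 1] is
    not the identity map. *)
Lemma endo_one_absorb a s : (a 1 * a s = a s) * (a s * a 1 = a s).
Proof. by rewrite -!endoM mul1g mulg1. Qed.

(** Left multiplication by a constant turns [s] and [u] into two distinct
    constants; a right factor then carries these to any prescribed pair. *)
Lemma const_collapse a s u i j :
  s != u -> a s = a u -> a (const_transf i) = a (const_transf j).
Proof.
move=> su asu.
have [x sux] : exists x, s x != u x.
  apply/existsP; apply: contraR su; rewrite negb_exists => /forallP su.
  by apply/eqP/transfP => x; apply/eqP; move: (su x); rewrite negbK.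
pose v : transf n := Transf [ffun y => if y == s x then i else j].
have -> : i = v (s x) by rewrite ffunE eqxx.
have -> : j = v (u x) by rewrite ffunE eq_sym (negPf sux).
by rewrite -!const_transf_mul !endoM !asu.
Qed.

(** The permutations fixing [p] number (n-1)!, fewer than the n!/2 elements of
    A_n, so [f] has a nontrivial kernel on A_n, and A_n is simple. *)
Lemma alt_trivial_fix (f : {morphism [set: 'S_n] >-> 'S_n}) (p : 'I_n) g :
  4 < n -> (forall h, f h p = p) -> ~~ odd_perm g -> f g = 1.
Proof.
move=> n_gt4 f_fix g_even.
have /simpleP[_ simpleA] : simple 'Alt_('I_n) by apply: simple_Alt5; rewrite card_ord.
have [ker1|kerA] : 'Alt_('I_n) :&: 'ker f = 1 \/ 'Alt_('I_n) :&: 'ker f = 'Alt_('I_n).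
  apply: (simpleA [group of _ :&: _]); apply: normalGI (subsetT _) (ker_normal _).
- have f_inj : {in 'Alt_('I_n) &, injective f}.
    move=> g1 g2 Ag1 Ag2 fg; apply/eqP; rewrite eq_mulgV1.
    suff : g1 * g2^-1 \in 'Alt_('I_n) :&: 'ker f by rewrite ker1 inE.
    rewrite inE groupM ?groupV //=; apply/kerP; rewrite ?inE //.
    by rewrite morphM ?inE // morphV ?inE // fg mulgV.
  have : #|'Alt_('I_n)| <= (n.-1)`!.
    have <- : #|[set h : 'S_n | perm_on [set~ p] h]| = (n.-1)`!.
      by rewrite cardsE card_perm cardsC1 card_ord.
    rewrite -(card_in_imset f_inj); apply/subset_leq_card/subsetP=> _ /imsetP[h _ ->].
    rewrite inE; apply/subsetP=> x; rewrite !inE; apply: contraNneq => ->.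
    by rewrite f_fix.
  have cardA : (2 * #|'Alt_('I_n)|)%N = n`!.
    by rewrite card_Alt card_ord // (ltn_trans _ n_gt4).
  rewrite -(leq_pmul2l (isT : 0 < 2)) cardA //.
  have -> : n`! = (n * n.-1`!)%N by rewrite -[in LHS](ltn_predK n_gt4) factS (ltn_predK n_gt4).
  by rewrite leq_pmul2r ?fact_gt0 // leqNgt (ltn_trans _ n_gt4).
have : g \in 'Alt_('I_n) by rewrite Alt_even.
by rewrite -kerA inE => /andP[_ /mker].
Qed.

(** A permutation [g] acts on the image of the idempotent [a 1] through
    [a (transf_of_perm g)]; extended by the identity elsewhere, this is a
    permutation of all points. *)
Section AlternatingCollapse.
Variables (a : endo n) (p : 'I_n).
Hypothesis fix_p : forall g, a (transf_of_perm g) p = p.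

(* The image of an idempotent map is its set of fixed points. *)
Let core : pred 'I_n := fun x => a 1 x == x.
Let act g x := if core x then a (transf_of_perm g) x else x.

Lemma act_core g x : core (act g x) = core x.
Proof.
rewrite /act; case cx: (core x) => //.
by rewrite /core -transf_mulE endo_one_absorb eqxx.
Qed.

Lemma actM g h x : act h (act g x) = act (g * h) x.
Proof.
have := act_core g x; rewrite /act; case: ifP => [_ ->|_ ->] //.
by rewrite -transf_mulE -endoM transf_of_permM.
Qed.

Lemma act1 x : act 1 x = x.
Proof. by rewrite /act transf_of_perm1; case: ifP => // /eqP. Qed.

Lemma act_inj g : injective (act g).
Proof. by apply: (can_inj (g := act g^-1)) => x; rewrite actM mulgV act1. Qed.

Let rho g : 'S_n := perm (@act_inj g).

Lemma rhoM : {in setT &, {morph rho : g h / g * h}}.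
Proof. by move=> g h _ _; apply/permP=> x; rewrite permM !permE actM. Qed.

Lemma rho_fix g : rho g p = p.
Proof. by rewrite permE /act fix_p; case: ifP. Qed.

Lemma rho_triv g : rho g = 1 -> a (transf_of_perm g) = a 1.
Proof.
move=> rho1; apply: transfP => x.
have /permP/(_ (a 1 x)) := rho1; rewrite perm1 permE /act /core.
by rewrite -!transf_mulE !endo_one_absorb eqxx.
Qed.

Lemma alt_collapse g : 4 < n -> ~~ odd_perm g -> a (transf_of_perm g) = a 1.
Proof.
move=> n_gt4 g_even; apply: rho_triv.
exact: (@alt_trivial_fix (Morphism rhoM) p g n_gt4 rho_fix g_even).
Qed.

End AlternatingCollapse.

(** * Non-injective endomorphisms *)

Section NonInjective.
Variable a : endo n.
Hypothesis n_gt4 : 4 < n.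
Hypothesis a_noninj : ~~ injectiveb a.

Let o m : 'I_n := insubd (Ordinal (ltn_trans (isT : 0 < 4) n_gt4)) m.

Lemma val_o m : m < n -> o m = m :> nat.
Proof. by move=> m_lt; rewrite insubdK. Qed.

(* The common value of [a] on the constants, hence a left zero of the image. *)
Let z := a (const_transf (o 0)).

Lemma const_zero i : a (const_transf i) = z.
Proof. by have /injectivePn[s [u su asu]] := a_noninj; apply: const_collapse su asu. Qed.

Lemma zero_mul s : z * a s = z.
Proof. by rewrite -endoM const_transf_mul const_zero. Qed.

(** Any point in the image of [z] is fixed by the action, as [z * a s = z]. *)
Lemma even_endo g : ~~ odd_perm g -> a (transf_of_perm g) = a 1.
Proof.
apply: (@alt_collapse a (z (o 0))) n_gt4 => h.
by rewrite -transf_mulE zero_mul.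
Qed.

Let o_lt m : m < 5 -> m < n. Proof. by move=> m_lt; apply: leq_trans m_lt n_gt4. Qed.

Let o_eq m1 m2 : m1 < n -> m2 < n -> (o m1 == o m2) = (m1 == m2).
Proof. by move=> m1_lt m2_lt; rewrite -val_eqE /= !val_o. Qed.

(* A transposition disjoint from {0, 1}, so that it commutes with [e1] below. *)
Let t0 : 'S_n := tperm (o 2) (o 3).

Lemma odd_endo g : odd_perm g -> a (transf_of_perm g) = a (transf_of_perm t0).
Proof.
move=> g_odd; have -> : g = (g * t0) * t0 by rewrite -mulgA tperm2 mulg1.
rewrite transf_of_permM endoM even_endo; last first.
  by rewrite odd_permM g_odd odd_tperm o_eq ?o_lt.
by rewrite endo_one_absorb.
Qed.

Let e1 := merge (o 1) (o 0).

(** Only the parity of [g] matters after applying [a], and a representative of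
    each parity, namely 1 or [t0], commutes with [e1]. *)
Lemma conj_merge g :
  a (transf_of_perm g^-1 * e1 * transf_of_perm g) = a e1.
Proof.
have [g_odd|g_even] := boolP (odd_perm g); last first.
  by rewrite !endoM !even_endo ?odd_permV // !endo_one_absorb.
rewrite !endoM !odd_endo ?odd_permV // -!endoM.
rewrite -[in X in X * _ * _](tpermV (o 2) (o 3) : t0^-1 = t0) -merge_conj.
by rewrite !tpermD ?o_eq ?o_lt.
Qed.

Lemma merge_endo i j : i != j -> a (merge i j) = a e1.
Proof.
move=> nij; pose g := tperm (o 1) i * tperm (tperm (o 1) i (o 0)) j.
have -> : i = g (o 1).
  (* The second transposition fixes [i]: the image of 0 under the first one
     differs from [i], which is the image of 1. *)
  rewrite permM tpermL tpermD //; last by rewrite eq_sym.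
  by rewrite -[X in _ != X](tpermL (o 1) i) (inj_eq perm_inj) o_eq ?o_lt.
have -> : j = g (o 0) by rewrite permM tpermL.
by rewrite merge_conj conj_merge.
Qed.

(** The constant map 0 is the product of the idempotents moving 1, 2, ..., n-1
    in turn to 0. All of them have the same idempotent image under [a]. *)
Lemma merge_zero : a e1 = z.
Proof.
(* The partial product of the first m factors. *)
pose u m : transf n := Transf [ffun x : 'I_n => if x <= m then o 0 else x].
have u_e1 m : 0 < m < n -> a (u m) = a e1.
  elim: m => // -[_ _|m IH m_lt].
    congr (a _); apply: transfP => x; rewrite !ffunE -val_eqE /= val_o ?o_lt //.
    case: ltngtP => //; rewrite ltnS leqn0 => /eqP x0.
    by apply: val_inj; rewrite /= val_o ?o_lt.
  have -> : u m.+2 = u m.+1 * merge (o m.+2) (o 0).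
    apply: transfP => x; rewrite !ffunE.
    have [x_le|x_gt] := leqP x m.+1.
      by rewrite leqW //; case: ifP.
    rewrite -val_eqE /= val_o //.
    by rewrite leq_eqVlt ltnS leqNgt x_gt orbF.
  have m2_neq0 : o m.+2 != o 0 by rewrite o_eq // o_lt.
  rewrite endoM IH ?(ltnW m_lt) // (merge_endo m2_neq0) -endoM.
  (* Idempotency of [e1] is its absorption by itself. *)
  congr (a _); apply: merge_absorb.
  by rewrite !ffunE eqxx; case: ifP.
rewrite -(u_e1 n.-1); last by rewrite -ltnS (ltn_predK n_gt4) leqnn (ltn_trans _ n_gt4).
congr (a _); apply: transfP => x; rewrite !ffunE.
by rewrite -ltnS (ltn_predK n_gt4) ltn_ord.
Qed.

(** The part of the theorem of Schein and Teclezghi that concerns endomorphisms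
    outside the automorphism group. *)
Lemma noninj_endo_phi : exists t e, endo_fun a = phi t e.
Proof.
exists (a (transf_of_perm t0)), z; apply/ffunP=> s.
have [g _|sS] := transf_symP s.
  rewrite phi_perm expg2; case: ifPn => [/odd_endo //|g_even].
  by rewrite -endoM -transf_of_permM !even_endo // odd_permM addbb.
rewrite phi_sing //; have /notin_symTP[[i j] /= nij sij] := sS.
by rewrite -(merge_absorb sij) endoM merge_endo // merge_zero zero_mul.
Qed.
End NonInjective.

(** * Rank and kernel *)

Lemma exists_odd_perm : 1 < n -> exists g, odd_perm g.
Proof.
move=> n_gt1; pose i := Ordinal (ltnW n_gt1); pose j := Ordinal n_gt1.
by exists (tperm i j); rewrite odd_tperm.
Qed.

Lemma const_transf_notin_symT i : 1 < n -> const_transf i \notin symT n.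
Proof.
move=> n_gt1; apply/notin_symTP.
by exists (Ordinal (ltnW n_gt1), Ordinal n_gt1); rewrite ?const_transfE.
Qed.

(** Apply [a] to the cube of an odd permutation, which is odd, and to products
    with a singular factor, which are singular. *)
Lemma endo_phi_admissible a t e : 1 < n -> endo_fun a = phi t e -> phi_admissible t e.
Proof.
move=> n_gt1 aE; have [g g_odd] := exists_odd_perm n_gt1.
have cS := const_transf_notin_symT (Ordinal n_gt1) n_gt1.
set c := const_transf _ in cS.
have ag : a (transf_of_perm g) = t by rewrite aE phi_perm g_odd.
have ac : a c = e by rewrite aE phi_sing.
have sing_mul s u : (s \notin symT n) || (u \notin symT n) -> a (s * u) = e.
  by move=> su; rewrite aE phi_sing // mul_symT negb_and.
split; first by rewrite -ag -!endoM -!transf_of_permM aE !phi_perm !odd_permM g_odd.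
- by rewrite -{1}ag -{1}ac -endoM sing_mul ?cS ?orbT.
- by rewrite -{1}ag -{1}ac -endoM sing_mul ?cS.
- by rewrite -{1 2}ac -endoM sing_mul ?cS.
Qed.

Lemma phi_rank a t e : 1 < n -> endo_fun a = phi t e ->
  endo_rank a = (1 + (t != e) + ((t * t)%g != t))%N.
Proof.
move=> n_gt1 aE; have [g g_odd] := exists_odd_perm n_gt1.
have cS := const_transf_notin_symT (Ordinal n_gt1) n_gt1.
have -> : endo_rank a = #|[set t; t * t; e]|.
  rewrite /endo_rank; congr #|pred_of_set _|; apply/setP=> u; rewrite !inE.
  apply/imsetP/idP => [[s _ ->]|].
    by rewrite aE ffunE -expg2; do ?case: ifP; rewrite eqxx ?orbT.
  case/orP=> [/orP[]|] /eqP->.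
  - by exists (transf_of_perm g); rewrite // aE phi_perm g_odd.
  - by exists (transf_of_perm 1); rewrite // aE phi_perm odd_perm1 expg2.
  - by exists (const_transf (Ordinal n_gt1)); rewrite // aE phi_sing.
have [tt|tt] := eqVneq (t * t) t.
  by rewrite tt setUid cards2; case: eqVneq.
have /andP[t_e tt_e] := admissible_sqr (endo_phi_admissible n_gt1 aE) tt.
by rewrite t_e setUC cardsU1 !inE negb_or eq_sym t_e eq_sym tt_e cards2 eq_sym tt.
Qed.

Lemma endo_rank_inj a : injective a -> endo_rank a = #|{: transf n}|.
Proof. by move=> a_inj; rewrite /endo_rank card_imset. Qed.

Lemma card_transf_gt3 : 3 < n -> 3 < #|{: transf n}|.
Proof.
move=> n_gt3; apply: leq_trans n_gt3 _; rewrite -[X in X <= _]card_ord.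
apply: (leq_card (@const_transf n)) => i j.
by move=> /(congr1 (fun s : transf n => s i)); rewrite !const_transfE.
Qed.

Lemma endo_rankM a b :
  (endo_rank (a * b) <= endo_rank a) && (endo_rank (a * b) <= endo_rank b).
Proof.
apply/andP; split.
  rewrite {1}/endo_rank (eq_imset (g := b \o a)) => [|s]; last exact: endo_mulE.
  by rewrite imset_comp leq_imset_card.
by apply/subset_leq_card/subsetP=> _ /imsetP[s _ ->]; rewrite endo_mulE imset_f.
Qed.

Section Rank.
Hypothesis n_gt4 : 4 < n.
Let n_gt1 : 1 < n. Proof. exact: ltn_trans n_gt4. Qed.

Variant endo_spec a : nat -> Prop :=
  | EndoInj of injective a : endo_spec a #|{: transf n}|
  | EndoPhi t e of endo_fun a = phi t e & phi_admissible t e :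
      endo_spec a (1 + (t != e) + ((t * t)%g != t))%N.

Lemma endo_rankP a : endo_spec a (endo_rank a).
Proof.
have [/injectiveP a_inj|a_noninj] := boolP (injectiveb a).
  by rewrite endo_rank_inj //; constructor.
have [t [e aE]] := noninj_endo_phi n_gt4 a_noninj.
by rewrite (phi_rank n_gt1 aE); exact: EndoPhi aE (endo_phi_admissible n_gt1 aE).
Qed.

Lemma phi_rank_lt (b1 b2 : bool) : (1 + b1 + b2 < #|{: transf n}|)%N.
Proof. by apply: leq_trans (card_transf_gt3 (ltnW n_gt4)); case: b1; case: b2. Qed.

(** The kernel of phi_{t,e} is determined by whether [t = e] and whether
    [t * t = t], the former implying the latter; so the possible kernels form
    a chain, and the rank tells how fine the kernel is. *)
Lemma rank_ker a b s u : endo_rank a <= endo_rank b -> b s = b u -> a s = a u.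
Proof.
case: (endo_rankP b) => [b_inj _ /b_inj-> //|tb eb bE [tttb teb etb eeb]].
case: (endo_rankP a) => [_|ta ea aE [ttta tea eta eea]].
  by rewrite leqNgt phi_rank_lt.
move=> le_ab.
have te_eq : tb = eb -> ta = ea.
  move=> E; move: le_ab; rewrite E eeb !eqxx; case: (eqVneq ta ea) => //.
have tt_eq : tb * tb = tb -> ta * ta = ta.
  move=> E; move: le_ab; rewrite E eqxx; case: (eqVneq (ta * ta) ta) => //.
  case: (eqVneq ta ea) => [->|_]; first by rewrite eea eqxx.
  by case: (tb != eb).
have tte_eq : tb * tb = eb -> ta * ta = ea.
  move=> E; have /te_eq-> // : tb = eb by rewrite -[LHS]tttb E etb.
rewrite aE bE !ffunE !expg2.
(* One case for each pair of classes among odd, even and singular. *)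
do 2![case: ifP => _; last case: ifP => _] => // E; auto; apply/esym; auto.
Qed.

Definition endo_ranks : seq nat := [:: #|{: transf n}|; 3; 2; 1%N].

Lemma mem_endo_ranks a : endo_rank a \in endo_ranks.
Proof.
case: (endo_rankP a) => [_|t e _ [_ _ _ ee]]; first exact: mem_head.
rewrite inE; apply/orP; right.
have [te|_] := eqVneq t e; last by case: (t * t != t).
by rewrite te ee eqxx.
Qed.

(** An idempotent phi_{t,c} must send [t] to itself; with [c] constant, this
    holds for [t] a transposition, for [t = 1] and for [t = c], which give
    ranks 3, 2 and 1. *)
Lemma exists_idempotent_rank r : r \in endo_ranks ->
  exists2 eta : endo n, idempotentE eta & endo_rank eta = r.
Proof.
pose i0 := Ordinal (ltnW n_gt1); pose i1 := Ordinal n_gt1.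
(* The value 2 is fixed by the transposition of 0 and 1, so that [c] absorbs
   that transposition on both sides. *)
pose c := const_transf (Ordinal (ltn_trans (isT : 2 < 4) n_gt4)).
have cS : c \notin symT n by apply: const_transf_notin_symT.
have cc : c * c = c by rewrite mul_const_transf.
have c1 : 1 != c.
  by apply: contraNneq cS => <-; rewrite -transf_of_perm1 transf_of_perm_symT.
have idem_rank t : phi_admissible t c -> phi t c t = t ->
  exists2 eta : endo n, idempotentE eta & endo_rank eta = (1 + (t != c) + ((t * t)%g != t))%N.
  move=> adm fix_t; have [eta etaE] := phi_endo adm.
  exists eta; last exact: phi_rank n_gt1 etaE.
  apply/eqP/endoP=> s; rewrite endo_mulE.
  suff : eta s \in [:: t; t * t; c].
    rewrite !inE => /or3P[] /eqP->; rewrite ?endoM etaE ?fix_t //.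
    exact: phi_sing.
  by rewrite etaE ffunE -expg2 !inE; do ?case: ifP; rewrite eqxx ?orbT.
rewrite !inE => /or4P[] /eqP->.
- exists 1; first by rewrite /idempotentE mulg1.
  by apply: endo_rank_inj => s u; rewrite !endo_oneE.
- pose tau := transf_of_perm (tperm i0 i1).
  have tautau : tau * tau = 1 by rewrite -transf_of_permM tperm2 transf_of_perm1.
  have tau_odd : odd_perm (tperm i0 i1) by rewrite odd_tperm.
  have [||eta eta_idem eta_rank] := @idem_rank tau; last exists eta => //.
  + split=> //; first by rewrite tautau mul1g.
      by rewrite mul_const_transf.
    by rewrite const_transf_mul transf_of_permE tpermD.
  + by rewrite phi_perm tau_odd.
  rewrite eta_rank tautau.
  have -> : tau != c by apply: contraNneq cS => <-; apply: transf_of_perm_symT.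
  suff -> : 1 != tau by [].
  rewrite -transf_of_perm1 (inj_eq (@transf_of_perm_inj n)).
  by apply: contraTneq tau_odd => <-; rewrite odd_perm1.
- have [||eta eta_idem eta_rank] := @idem_rank 1; last exists eta => //.
  + by split; rewrite ?mul1g ?mulg1.
  + by rewrite -transf_of_perm1 phi_perm odd_perm1 expg2 transf_of_perm1 mul1g.
  by rewrite eta_rank mul1g eqxx c1.
have [||eta eta_idem eta_rank] := @idem_rank c; last exists eta => //.
- by split; rewrite ?cc.
- exact: phi_sing.
by rewrite eta_rank cc !eqxx.
Qed.

Lemma exists_idempotent a : exists2 eta : endo n, idempotentE eta & endo_rank eta = endo_rank a.
Proof. exact: exists_idempotent_rank (mem_endo_ranks a). Qed.

(** * The relations in terms of rank *)

(** [eta * a = a] means that the kernel of [eta] is contained in that of [a],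
    since [s] and [eta s] have the same image under the idempotent [eta]. *)
Lemma idempotent_fix_rank eta a : idempotentE eta ->
  (eta * a == a) = (endo_rank a <= endo_rank eta).
Proof.
move=> /eqP eta_idem; apply/eqP/idP => [<-|le_rank].
  by case/andP: (endo_rankM eta a).
apply: endoP => s; rewrite endo_mulE; apply: (rank_ker le_rank).
by rewrite -endo_mulE eta_idem.
Qed.

(** For an idempotent [eta], lying in the right ideal of [eta] means [eta * a = a]. *)
Lemma Rbelow_rank eta a : idempotentE eta -> Rbelow a eta = (endo_rank a <= endo_rank eta).
Proof.
move=> eta_idem; rewrite -idempotent_fix_rank //; apply/subsetP/eqP => [sub|<- _ /imsetP[c _ ->]].
  have /sub/imsetP[c _] : a \in [set a * c | c : endo n].
    by apply/imsetP; exists 1; rewrite ?mulg1.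
  by move=> ->; rewrite mulgA (eqP eta_idem).
by apply/imsetP; exists (a * c); rewrite // mulgA.
Qed.

(** Rank cannot increase under multiplication on either side, which bounds the
    rank on a principal ideal; conversely the rank bound already puts [a] in
    the smaller right ideal of [eta]. *)
Lemma Jbelow_rank eta a : idempotentE eta -> Jbelow a eta = (endo_rank a <= endo_rank eta).
Proof.
move=> eta_idem; apply/subsetP/idP => [sub|].
  have /sub/imset2P[c d _ _ ->] : a \in [set c * a * d | c : endo n, d : endo n].
    by apply/imset2P; exists 1 1; rewrite ?mulg1 ?mul1g.
  apply: leq_trans (proj1 (andP (endo_rankM (c * eta) d))) _.
  by case/andP: (endo_rankM c eta).
rewrite -idempotent_fix_rank // => /eqP eta_a _ /imset2P[c d _ _ ->].
by apply/imset2P; exists c (a * d); rewrite // -{1}eta_a !mulgA.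
Qed.

(** Test the equivalence on idempotents having the ranks of [a] and of [b]. *)
Lemma rank_eq_idem a b :
  (forall eta, idempotentE eta ->
     (endo_rank a <= endo_rank eta <-> endo_rank b <= endo_rank eta)) ->
  endo_rank a = endo_rank b.
Proof.
have [ea ea_idem ea_rank] := exists_idempotent a.
have [eb eb_idem eb_rank] := exists_idempotent b.
move=> ab; have [_ le_ab] := ab eb eb_idem; have [le_ba _] := ab ea ea_idem.
by apply/eqP; rewrite eqn_leq -{1}eb_rank -{2}ea_rank le_ab ?le_ba ?ea_rank ?eb_rank.
Qed.

Lemma Rstar_idem_fix a b eta : Rstar a b -> (eta * a == a) = (eta * b == b).
Proof. by move=> /forallP/(_ eta)/forallP/(_ 1)/eqP; rewrite !mul1g. Qed.

Lemma Rstar_rank a b : Rstar a b = (endo_rank a == endo_rank b).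
Proof.
apply/idP/eqP => [Rab|rank_ab].
  by apply: rank_eq_idem => eta eta_idem; rewrite -!idempotent_fix_rank // (Rstar_idem_fix eta Rab).
have cancel c d a' b' : endo_rank a' = endo_rank b' -> c * b' = d * b' -> c * a' = d * a'.
  move=> rank_ab' E; apply: endoP => s; rewrite !endo_mulE.
  by apply: (@rank_ker a' b'); rewrite ?rank_ab' // -!endo_mulE E.
by apply/forallP=> c; apply/forallP=> d; apply/eqP; apply/eqP/eqP; exact: cancel.
Qed.

Lemma Rtilde_idem_fix a b :
  Rtilde a b <-> forall eta, idempotentE eta -> (eta * a == a) = (eta * b == b).
Proof.
split=> [/forallP Rab eta eta_idem|Rab]; first by move/implyP/(_ eta_idem)/eqP: (Rab eta).
by apply/forallP=> eta; apply/implyP=> /Rab ->.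
Qed.

Lemma Rtilde_rank a b : Rtilde a b = (endo_rank a == endo_rank b).
Proof.
apply/idP/eqP => [/Rtilde_idem_fix Rab|rank_ab].
  by apply: rank_eq_idem => eta eta_idem; rewrite -!idempotent_fix_rank // Rab.
by apply/Rtilde_idem_fix => eta eta_idem; rewrite !idempotent_fix_rank // rank_ab.
Qed.

(** * The classes *)

Lemma aut_endo_rank : aut_endo n = [set a | endo_rank a == #|{: transf n}|].
Proof.
apply/setP=> a; rewrite !inE; apply/andP/idP => [[/injectiveP a_inj _]|].
  by rewrite endo_rank_inj.
case: (endo_rankP a) => [a_inj _|t e _ _]; last by rewrite ltn_eqF ?phi_rank_lt.
split; first exact/injectiveP.
by apply/forallP=> t; apply/existsP; exists (invF a_inj t); rewrite f_invF.
Qed.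

(** Reduces the description of a class of phi_{t,e} by rank to a Boolean identity
    in the equalities that enter the rank formula. *)
Lemma mem_phi_class (P : rel (transf n)) r :
  (forall t e, phi_admissible t e -> P t e = (1 + (t != e) + ((t * t)%g != t) == r)%N) ->
  r < #|{: transf n}| -> phi_class P = [set a | endo_rank a == r].
Proof.
move=> PE r_lt; apply/setP=> a; rewrite !inE.
apply/existsP/idP => [[t /existsP[e /andP[Pte /eqP aE]]]|].
  have adm := endo_phi_admissible n_gt1 aE.
  by rewrite (phi_rank n_gt1 aE) -PE.
case: (endo_rankP a) => [_|t e aE adm]; first by rewrite gtn_eqF.
by rewrite -PE // => Pte; exists t; apply/existsP; exists e; rewrite Pte aE eqxx.
Qed.

Lemma phi_classU (P Q : rel (transf n)) :
  phi_class P :|: phi_class Q = phi_class (fun t e => P t e || Q t e).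
Proof.
apply/setP=> a; rewrite !inE; apply/orP/existsP => [[]|] /=.
- by case/existsP=> t /existsP[e /andP[Pte aE]]; exists t; apply/existsP; exists e; rewrite Pte.
- by case/existsP=> t /existsP[e /andP[Qte aE]]; exists t; apply/existsP; exists e; rewrite Qte orbT.
case=> t /existsP[e /andP[/orP[] Pte aE]]; [left|right];
  by apply/existsP; exists t; apply/existsP; exists e; rewrite Pte.
Qed.

Lemma small_rank_lt r : r <= 3 -> r < #|{: transf n}|.
Proof. by move=> r_le; apply: leq_ltn_trans r_le (card_transf_gt3 (ltnW n_gt4)). Qed.

Lemma phiE1_rank : phiE1 n = [set a | endo_rank a == 1%N].
Proof.
apply: mem_phi_class (small_rank_lt _) => // t e [_ _ _ ee].
by have [->|_] := eqVneq t e; rewrite ?ee ?eqxx.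
Qed.

Lemma altT1 : (1 : transf n) \in altT n.
Proof. by rewrite -transf_of_perm1 transf_of_perm_altT odd_perm1. Qed.

(** A group has only one idempotent. *)
Lemma symT_idem t : t \in symT n -> (t * t == t) = (t == 1).
Proof.
case: (transf_symP t) => // g _ _.
rewrite -transf_of_permM -transf_of_perm1 !(inj_eq (@transf_of_perm_inj n)).
by rewrite -[X in _ == X]mulg1 (inj_eq (mulgI g)).
Qed.

Lemma phiE2C_rank : phiE2 n :|: phiC n = [set a | endo_rank a == 2].
Proof.
rewrite phi_classU; apply: mem_phi_class (small_rank_lt _) => // t e adm.
rewrite expg2; have e1 := admissible_e1 adm; have sq := admissible_sqr adm.
have [tt|tt] := eqVneq (t * t) t; last first.
  have /andP[-> _] := sq tt; rewrite /= andbF orbF.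
  by apply/negbTE; apply: contra tt => /andP[/eqP-> _]; rewrite mulg1.
have [te|nte] := eqVneq t e.
  by rewrite -te /= andbF orbF; case: (t == 1).
rewrite (e1 nte) !andbT; have [/symT_idem <-|] := boolP (t \in symT n).
  by rewrite tt eqxx.
by rewrite orbT.
Qed.

Lemma phiE3AB_rank : phiE3 n :|: phiA n :|: phiB n = [set a | endo_rank a == 3].
Proof.
rewrite !phi_classU; apply: mem_phi_class (small_rank_lt _) => // t e adm.
rewrite expg2 in_setD; have e1 := admissible_e1 adm; have sq := admissible_sqr adm.
have [tt|tt] := eqVneq (t * t) t; last first.
  have /andP[nte ntte] := sq tt; rewrite nte (e1 nte) ntte !andbT /=.
  case tA: (t \in altT n) => /=; last by case: (t \in symT n).
  by rewrite -(symT_idem (altT_sub tA)) tt.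
rewrite andbF orbF /=.
have -> : (1 + (t != e) + 0 == 3)%N = false by case: (t != e).
have [tS|tS] := boolP (t \in symT n); last first.
  by rewrite andbF /=; case tA: (t \in altT n) => //; rewrite (altT_sub tA) in tS.
have -> : t = 1 by apply/eqP; rewrite -symT_idem ?tt.
by rewrite altT1 eqxx.
Qed.

Lemma Rstar_classes :
  equivalence_partition (@Rstar n) [set: endo n]
  = [set aut_endo n; phiE3 n :|: phiA n :|: phiB n; phiE2 n :|: phiC n; phiE1 n].
Proof.
rewrite aut_endo_rank phiE3AB_rank phiE2C_rank phiE1_rank.
apply/setP=> X; apply/imsetP/idP => [[a _ ->]|].
  have -> : [set b in [set: endo n] | Rstar a b] = [set b | endo_rank b == endo_rank a].
    by apply/setP=> b; rewrite !inE Rstar_rank eq_sym.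
  by have := mem_endo_ranks a; rewrite !inE => /or4P[] /eqP->; rewrite eqxx ?orbT.
have attained r : r \in endo_ranks -> exists2 a, a \in [set: endo n] &
    [set b | endo_rank b == r] = [set b in [set: endo n] | Rstar a b].
  case/exists_idempotent_rank=> eta _ <-; exists eta; rewrite ?inE //.
  by apply/setP=> b; rewrite !inE Rstar_rank eq_sym.
rewrite !inE -!orbA => /or4P[] /eqP->; apply: attained; by rewrite !inE eqxx ?orbT.
Qed.

End Rank.
End Endomorphisms.

Theorem proposition6p5 (n : nat) (hn : 5 <= n) :
  (forall a b : endo n,
     [<-> Rstar a b;
          Rtilde a b;
          forall eta : endo n, idempotentE eta -> (Rbelow a eta <-> Rbelow b eta);
          forall eta : endo n, idempotentE eta -> (Jbelow a eta <-> Jbelow b eta);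
          endo_rank a = endo_rank b])
  /\ (@Rtilde n =2 @Rstar n
      /\ left_congruence (@Rstar n)
      /\ equivalence_partition (@Rstar n) [set: endo n]
         = [set aut_endo n; phiE3 n :|: phiA n :|: phiB n; phiE2 n :|: phiC n; phiE1 n]).
Proof.
split=> [a b|].
  tfae.
  - by rewrite Rstar_rank // Rtilde_rank.
  - by rewrite Rtilde_rank // => /eqP rank_ab eta eta_idem; rewrite !Rbelow_rank // rank_ab.
  - move=> Rab eta eta_idem; rewrite !Jbelow_rank // -!Rbelow_rank //; exact: Rab.
  - move=> Jab; apply: rank_eq_idem => // eta eta_idem.
    by rewrite -!Jbelow_rank //; apply: Jab.
  - by rewrite Rstar_rank // => ->.
split=> [a b|]; first by rewrite Rtilde_rank // Rstar_rank.
split; last exact: Rstar_classes.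
split=> [a b c|c a b]; first by rewrite !Rstar_rank // eqxx; split=> // /eqP->.
move=> /forallP Rab; apply/forallP=> x; apply/forallP=> y.
by rewrite !mulgA; move/forallP: (Rab (mulg x c)) => /(_ (mulg y c)).
Qed.
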